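(* The surfaces of revolution $\Sigma=\{(t,r):t=f(r)\}$ in the Heisenberg group $\mathbb{H}$ that have constant horizontal mean curvature $H^h_\Sigma=h$ are given by: (1) the two parameter family of surfaces $$(t-C')^2=\left(\frac{C}{8}\right)^2\left(16r^2-C^2\right),$$ if $h=0$; (2) the two parameter family of surfaces $$t-C'=\mp\frac{1}{2h}\sqrt{\frac{8}{h}(s-C)-s^2}\pm\frac{2}{h^2}\arcsin\left(\frac{s-4/h}{\sqrt{16/h^2-8C/h}}\right),$$ for $s=2hr^2+C$, $16/h^2-8C/h>0$ and $(8/h)(s-C)-s^2>0$, if $h\neq0$. Here $C,C'\in\mathbb{R}$ are the parameters of the families.
   Context: The Heisenberg group $\mathbb{H}$ is $\mathbb{R}^3$ with coordinates $(x,y,t)$ and group law $(x,y,t)\cdot(x',y',t')=(x+x',y+y',t+t'+2(yx'-xy'))$. Its left-invariant frame is $X=\partial_x+2y\,\partial_t$, $Y=\partial_y-2x\,\partial_t$, $T=\partial_t$. For a surface $\Sigma=\{u=0\}$ with $C^2$ defining function $u$, put $\|\nabla_Hu\|=\sqrt{(Xu)^2+(Yu)^2}$. At non-characteristic points (those where $\|\nabla_Hu\|\neq0$) the horizontal mean curvature is $$H^h_\Sigma=X\left(\frac{Xu}{\|\nabla_Hu\|}\right)+Y\left(\frac{Yu}{\|\nabla_Hu\|}\right).$$ A surface of revolution is a surface defined by $u(x,y,t)=t-f(r)=0$ with $r=\sqrt{x^2+y^2}$.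
   Formalization: In (2) the upper signs are matched with curvature h for the defining function f(r)-t and the lower signs with t-f(r), since with u=t-f(r) the upper signs have curvature -h; the formula in (2) is asserted only for r>0. *)

(* Defs.v *)
From Stdlib Require Import Reals.
From Coquelicot Require Import Coquelicot.
Open Scope R_scope.

(** Points [(x, y, t)] of the Heisenberg group. *)
Definition heis : Type := (R * R * R)%type.

Definition hmul (p q : heis) : heis :=
  let '(x, y, t) := p in
  let '(x', y', t') := q in
  (x + x', y + y', t + t' + 2 * (y * x' - x * y')).

Definition dx (u : heis -> R) (p : heis) : R :=
  let '(x, y, t) := p in Derive (fun x' => u (x', y, t)) x.
Definition dy (u : heis -> R) (p : heis) : R :=
  let '(x, y, t) := p in Derive (fun y' => u (x, y', t)) y.
Definition dt (u : heis -> R) (p : heis) : R :=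
  let '(x, y, t) := p in Derive (fun t' => u (x, y, t')) t.

(** [Derive] is total, so existence of the partial derivatives is required
    separately from their continuity. *)
Definition has_partials (u : heis -> R) (p : heis) : Prop :=
  let '(x, y, t) := p in
  ex_derive (fun x' => u (x', y, t)) x /\
  ex_derive (fun y' => u (x, y', t)) y /\
  ex_derive (fun t' => u (x, y, t')) t.

Definition C1_on (U : heis -> Prop) (u : heis -> R) : Prop :=
  forall p, U p ->
    has_partials u p /\
    continuous (dx u) p /\ continuous (dy u) p /\ continuous (dt u) p.

Definition C2_on (U : heis -> Prop) (u : heis -> R) : Prop :=
  C1_on U u /\ C1_on U (dx u) /\ C1_on U (dy u) /\ C1_on U (dt u).

(** At [p], [hX] and [hY] differentiate along the velocities [(1, 0, 2y)] and
    [(0, 1, -2x)] at [s = 0] of [hmul p (s, 0, 0)] and [hmul p (0, s, 0)]. *)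
Definition hX (u : heis -> R) (p : heis) : R :=
  let '(x, y, t) := p in dx u p + 2 * y * dt u p.
Definition hY (u : heis -> R) (p : heis) : R :=
  let '(x, y, t) := p in dy u p - 2 * x * dt u p.

Definition hgrad_norm (u : heis -> R) (p : heis) : R :=
  sqrt (hX u p ^ 2 + hY u p ^ 2).

Definition noncharacteristic (u : heis -> R) (p : heis) : Prop :=
  hgrad_norm u p <> 0.

Definition hcurv (u : heis -> R) (p : heis) : R :=
  hX (fun q => hX u q / hgrad_norm u q) p +
  hY (fun q => hY u q / hgrad_norm u q) p.

(** The surface [{u = 0}] inside the open set [U] has constant horizontal mean
    curvature [h]. The sign of [hcurv] depends on the orientation: [u] and
    [- u] define the same surface but have opposite curvatures. *)
Definition constant_hcurv (U : heis -> Prop) (u : heis -> R) (h : R) : Prop :=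
  forall p, U p -> u p = 0 -> noncharacteristic u p -> hcurv u p = h.

Definition radius (p : heis) : R :=
  let '(x, y, t) := p in sqrt (x ^ 2 + y ^ 2).

(** Intervals of radii, open relatively to [[0, +oo)]; the axis [r = 0] may or
    may not belong to the interval. *)
Definition radial_interval (J : R -> Prop) : Prop :=
  (forall r, J r -> 0 <= r) /\
  (forall r, J r -> locally r (fun r' => 0 <= r' -> J r')) /\
  (forall a b c, J a -> J c -> a <= b <= c -> J b).

Definition over (J : R -> Prop) (p : heis) : Prop := J (radius p).

Definition revol (f : R -> R) (p : heis) : R :=
  let '(x, y, t) := p in t - f (radius p).

(** The profile [f] matters only on [J]; its values elsewhere are junk. *)
Definition surface_of_revolution (J : R -> Prop) (f : R -> R) : Prop :=
  radial_interval J /\ C2_on (over J) (revol f).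

(** Ingredients of the family for [h <> 0]. As [fam_rad h C 0 = - C ^ 2 <= 0],
    the condition [fam_rad > 0] excludes the axis [r = 0], whose points are
    characteristic. *)
Definition fam_s (h C r : R) : R := 2 * h * r ^ 2 + C.
Definition fam_rad (h C r : R) : R :=
  8 / h * (fam_s h C r - C) - fam_s h C r ^ 2.
Definition fam_disc (h C : R) : R := 16 / h ^ 2 - 8 * C / h.

(* Main.v *)
Require Import Defs.
From Stdlib Require Import Reals.
From Coquelicot Require Import Coquelicot.
From Stdlib Require Import Lra Classical.
Open Scope R_scope.

(** Write [N = sqrt (f'^2 + 4 r^2)] for the norm of the horizontal gradient of
    [u = t - f r].  Off the axis,
<<
      Xu / N = 2 y / N - x f' / (r N),    Yu / N = - 2 x / N - y f' / (r N).
>>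
    Both depend on [(x, y)] only, so the curvature is the planar divergence of
    this field.  The rotational part [(2 y / N, - 2 x / N)] has no divergence,
    and the radial part contributes [- G' / r] with [G = r f' / N], the [flux]
    of the profile ([hcurv_revol]).  Axis points are characteristic, because
    an even differentiable function has derivative [0] at [0].

    Constant curvature [h] therefore means [G' = - h r], which has the first
    integral [G = - s / 4] with [s = 2 h r^2 + C]
    ([constant_hcurv_first_integral]).  As [|G| < r], this can be solved for
    the slope: [16 r^2 - s^2 > 0] and [f' = - 2 r s / sqrt (16 r^2 - s^2)]
    ([flux_slope]).  A quadrature ends the proof.

    If [h <> 0], the right-hand side has the explicit primitive [fam_profile],
    and [fam_rad] is [16 r^2 - s^2] ([constant_hcurv_nonzero]).  The opposite
    orientation follows from the substitution [(h, C) -> (- h, - C)], which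
    preserves [fam_rad] and [fam_disc] and negates [fam_profile].

    If [h = 0], then [s = C] and the primitive is
    [- (C / 8) sqrt (16 r^2 - C^2)]; squaring it gives the stated equation.
    Conversely, the squared equation does not fix the sign of [f'], but
    differentiating it gives [G^2 = (C / 4)^2], which suffices for [G' = 0]. *)

(** * Open intervals of positive radii *)

Lemma radial_interval_pos_locally (J : R -> Prop) (r : R) :
  radial_interval J -> J r -> 0 < r -> locally r (fun r' => J r' /\ 0 < r').
Proof.
  intros (_ & Hopen & _) Jr r_gt0.
  assert (Hpos : locally r (fun r' => 0 < r')) by exact (open_gt 0 r r_gt0).
  generalize (filter_and _ _ (Hopen r Jr) Hpos).
  apply filter_imp; intros r' [HJ Hr']; split; auto; apply HJ; lra.
Qed.

Lemma radial_interval_near_axis (J : R -> Prop) :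
  radial_interval J -> J 0 ->
  exists d, 0 < d /\ forall r, 0 < r < d -> J r.
Proof.
  intros (_ & Hopen & _) J0; destruct (Hopen 0 J0) as [d Hd].
  exists d; split; [apply cond_pos|].
  intros r Hr; apply Hd; [|lra].
  unfold ball; simpl; unfold AbsRing_ball, abs, minus, plus, opp; simpl.
  rewrite Rabs_pos_eq; lra.
Qed.

(** The family parameters must be exhibited even when [J] is empty, where no
    point bounds the discriminant; relative openness excludes [J = {0}], so
    these are the only two cases. *)
Lemma radial_interval_pos_witness (J : R -> Prop) :
  radial_interval J ->
  (exists r, J r /\ 0 < r) \/ (forall r, ~ J r).
Proof.
  intros HJ.
  destruct (classic (exists r, J r)) as [[r Jr]|Hno].
  - left; destruct (proj1 HJ r Jr) as [r_gt0|r_eq0].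
    + exists r; auto.
    + subst r; destruct (radial_interval_near_axis J HJ Jr) as (d & d_gt0 & HJd).
      exists (d / 2); split; [apply HJd|]; lra.
  - right; intros r Jr; apply Hno; exists r; exact Jr.
Qed.

Lemma radial_interval_constant (J : R -> Prop) (g : R -> R) :
  radial_interval J ->
  (forall r, J r -> 0 < r -> is_derive g r 0) ->
  exists c, forall r, J r -> 0 < r -> g r = c.
Proof.
  intros HJ Hg.
  destruct (radial_interval_pos_witness J HJ) as [[a [Ja a_gt0]]|Hno].
  - exists (g a); intros r Jr r_gt0.
    destruct HJ as (_ & _ & Hconv).
    destruct (Rtotal_order a r) as [Hlt|[->|Hgt]]; auto.
    + symmetry; apply (eq_is_derive g a r); auto.
      intros t Ht; apply Hg; [apply (Hconv a t r)|]; auto; lra.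
    + apply (eq_is_derive g r a); auto.
      intros t Ht; apply Hg; [apply (Hconv r t a)|]; auto; lra.
  - exists 0; intros r Jr; destruct (Hno r Jr).
Qed.

(** * Derivatives of radial functions *)

Lemma radius_on_axis (x t : R) : 0 <= x -> radius (x, 0, t) = x.
Proof.
  intros Hx; unfold radius.
  replace (x ^ 2 + 0 ^ 2) with (x ^ 2) by ring; now apply sqrt_pow2.
Qed.

Lemma radius_sqr (x y t : R) : radius (x, y, t) ^ 2 = x ^ 2 + y ^ 2.
Proof. unfold radius; rewrite pow2_sqrt; nra. Qed.

Lemma radius_eq0 (x y t : R) : radius (x, y, t) = 0 -> x = 0 /\ y = 0.
Proof. intros H; generalize (radius_sqr x y t); rewrite H; intros; nra. Qed.

Lemma radius_arg_pos (x y t : R) : 0 < radius (x, y, t) -> 0 < x ^ 2 + y ^ 2.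
Proof. intros H; rewrite <- (radius_sqr x y t); nra. Qed.

Lemma is_derive_radius_x (x y t : R) :
  0 < radius (x, y, t) ->
  is_derive (fun x' => radius (x', y, t)) x (x / radius (x, y, t)).
Proof.
  intros H; generalize (radius_arg_pos _ _ _ H); intros H'.
  unfold radius in *; auto_derive; [nra|].
  replace (x * (x * 1) + y * (y * 1)) with (x ^ 2 + y ^ 2) by ring.
  field; lra.
Qed.

Lemma is_derive_radius_y (x y t : R) :
  0 < radius (x, y, t) ->
  is_derive (fun y' => radius (x, y', t)) y (y / radius (x, y, t)).
Proof.
  intros H; generalize (radius_arg_pos _ _ _ H); intros H'.
  unfold radius in *; auto_derive; [nra|].
  replace (x * (x * 1) + y * (y * 1)) with (x ^ 2 + y ^ 2) by ring.
  field; lra.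
Qed.

Lemma is_derive_radial_x (g : R -> R) (x y t l : R) :
  0 < radius (x, y, t) -> is_derive g (radius (x, y, t)) l ->
  is_derive (fun x' => g (radius (x', y, t))) x (l * (x / radius (x, y, t))).
Proof.
  intros Hr Hg; rewrite Rmult_comm.
  exact (is_derive_comp g (fun x' => radius (x', y, t)) x _ _ Hg
           (is_derive_radius_x x y t Hr)).
Qed.

Lemma is_derive_radial_y (g : R -> R) (x y t l : R) :
  0 < radius (x, y, t) -> is_derive g (radius (x, y, t)) l ->
  is_derive (fun y' => g (radius (x, y', t))) y (l * (y / radius (x, y, t))).
Proof.
  intros Hr Hg; rewrite Rmult_comm.
  exact (is_derive_comp g (fun y' => radius (x, y', t)) y _ _ Hg
           (is_derive_radius_y x y t Hr)).
Qed.

Lemma locally_radius_x (P : R -> Prop) (x y t : R) :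
  0 < radius (x, y, t) -> locally (radius (x, y, t)) P ->
  locally x (fun x' => P (radius (x', y, t))).
Proof.
  intros Hr HP.
  apply (ex_derive_continuous (fun x' => radius (x', y, t))); auto.
  eexists; apply is_derive_radius_x, Hr.
Qed.

Lemma locally_radius_y (P : R -> Prop) (x y t : R) :
  0 < radius (x, y, t) -> locally (radius (x, y, t)) P ->
  locally y (fun y' => P (radius (x, y', t))).
Proof.
  intros Hr HP.
  apply (ex_derive_continuous (fun y' => radius (x, y', t))); auto.
  eexists; apply is_derive_radius_y, Hr.
Qed.

(** * Regularity of the profile *)

(** Restricting to the meridian [y = t = 0], where the radius is [x], turns
    partial derivatives in space into derivatives of the profile. *)
Lemma ex_derive_meridian (g : R -> R) (r : R) :
  0 < r -> ex_derive (fun x => g (radius (x, 0, 0))) r -> ex_derive g r.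
Proof.
  intros r_gt0; apply ex_derive_ext_loc.
  generalize (open_gt 0 r r_gt0); apply filter_imp; intros x Hx.
  now rewrite radius_on_axis by lra.
Qed.

Lemma profile_ex_derive (J : R -> Prop) (f : R -> R) (r : R) :
  surface_of_revolution J f -> J r -> 0 < r -> ex_derive f r.
Proof.
  intros [_ [HC1 _]] Jr r_gt0.
  assert (Hover : over J (r, 0, 0)) by (unfold over; now rewrite radius_on_axis by lra).
  destruct (HC1 _ Hover) as [[Hx _] _].
  apply ex_derive_meridian; auto.
  apply ex_derive_ext with (fun x => - (0 - f (radius (x, 0, 0)))).
  - intros x; simpl; ring.
  - exact (ex_derive_opp (fun x => 0 - f (radius (x, 0, 0))) r Hx).
Qed.

Lemma dx_revol (J : R -> Prop) (f : R -> R) (x y t : R) :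
  surface_of_revolution J f ->
  J (radius (x, y, t)) -> 0 < radius (x, y, t) ->
  dx (revol f) (x, y, t) = - (Derive f (radius (x, y, t)) * (x / radius (x, y, t))).
Proof.
  intros HS HJ Hr; unfold dx, revol; apply is_derive_unique.
  replace (- _) with (0 - Derive f (radius (x, y, t)) * (x / radius (x, y, t))) by ring.
  apply (is_derive_minus (V := R_NormedModule) (fun _ => t) (fun x' => f (radius (x', y, t)))).
  - apply (is_derive_const (V := R_NormedModule)).
  - apply is_derive_radial_x; auto; apply Derive_correct.
    eapply profile_ex_derive; eauto.
Qed.

Lemma dy_revol (J : R -> Prop) (f : R -> R) (x y t : R) :
  surface_of_revolution J f ->
  J (radius (x, y, t)) -> 0 < radius (x, y, t) ->
  dy (revol f) (x, y, t) = - (Derive f (radius (x, y, t)) * (y / radius (x, y, t))).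
Proof.
  intros HS HJ Hr; unfold dy, revol; apply is_derive_unique.
  replace (- _) with (0 - Derive f (radius (x, y, t)) * (y / radius (x, y, t))) by ring.
  apply (is_derive_minus (V := R_NormedModule) (fun _ => t) (fun y' => f (radius (x, y', t)))).
  - apply (is_derive_const (V := R_NormedModule)).
  - apply is_derive_radial_y; auto; apply Derive_correct.
    eapply profile_ex_derive; eauto.
Qed.

Lemma dt_revol (f : R -> R) (x y t : R) : dt (revol f) (x, y, t) = 1.
Proof.
  unfold dt, revol; apply is_derive_unique.
  change (is_derive (fun t' => t' - f (radius (x, y, 0))) t 1).
  auto_derive; auto; ring.
Qed.

Lemma profile_ex_derive2 (J : R -> Prop) (f : R -> R) (r : R) :
  surface_of_revolution J f -> J r -> 0 < r -> ex_derive (Derive f) r.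
Proof.
  intros HS Jr r_gt0; generalize HS; intros [HJ [_ [HC1 _]]].
  assert (Hover : over J (r, 0, 0)) by (unfold over; now rewrite radius_on_axis by lra).
  destruct (HC1 _ Hover) as [[Hx _] _].
  apply ex_derive_ext_loc with (fun x => - dx (revol f) (x, 0, 0)).
  - generalize (radial_interval_pos_locally J r HJ Jr r_gt0); apply filter_imp.
    intros x [Jx x_gt0].
    rewrite (dx_revol J) by (rewrite ?radius_on_axis by lra; auto).
    rewrite radius_on_axis by lra.
    change (- - (Derive f x * (x / x)) = Derive f x :> R); field; lra.
  - exact (ex_derive_opp _ r Hx).
Qed.

Lemma derive_even_0 (g : R -> R) :
  (forall x, g (- x) = g x) -> ex_derive g 0 -> Derive g 0 = 0.
Proof.
  intros Heven Hg.
  assert (H : Derive g 0 = - Derive g 0); [|lra].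
  transitivity (Derive (fun x => g (- x)) 0).
  - apply Derive_ext; intros x; now rewrite Heven.
  - rewrite (Derive_comp g Ropp), Derive_opp, Derive_id.
    + rewrite Ropp_0; ring.
    + now rewrite Ropp_0.
    + auto_derive; auto.
Qed.

(** On a line parallel to the [x]- or [y]-axis through a point of the axis
    of revolution, [revol f] is even, so its partial
    derivatives in [x] and [y] vanish there; the terms
    [2 y] and [- 2 x] of the frame vanish as well. *)
Lemma revol_axis_characteristic (J : R -> Prop) (f : R -> R) (x y t : R) :
  surface_of_revolution J f -> over J (x, y, t) ->
  noncharacteristic (revol f) (x, y, t) -> 0 < radius (x, y, t).
Proof.
  intros [HJ [HC1 _]] Hover Hnc.
  destruct (HC1 _ Hover) as [[Hx [Hy _]] _].
  destruct (proj1 HJ _ Hover) as [H|H]; [exact H|].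
  symmetry in H; destruct (radius_eq0 _ _ _ H); subst x y.
  destruct Hnc; unfold hgrad_norm, hX, hY.
  replace (dx (revol f) (0, 0, t)) with 0.
  replace (dy (revol f) (0, 0, t)) with 0.
  - rewrite !Rmult_0_r, !Rmult_0_l, Rplus_0_r, Rminus_0_r.
    replace (0 ^ 2 + 0 ^ 2) with 0 by ring; apply sqrt_0.
  - symmetry; apply derive_even_0; auto.
    intros y; unfold revol, radius.
    now replace ((- y) ^ 2) with (y ^ 2) by ring.
  - symmetry; apply derive_even_0; auto.
    intros x; unfold revol, radius.
    now replace ((- x) ^ 2) with (x ^ 2) by ring.
Qed.

(** Differentiability of [revol f] at the origin makes [x |-> f |x|]
    continuous at [0], so the value at the axis is the limit of the values at
    positive radii. *)
Lemma profile_axis_value (J : R -> Prop) (f : R -> R) (d c : R) :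
  surface_of_revolution J f -> J 0 -> 0 < d ->
  (forall r, 0 < r < d -> f r = c) -> f 0 = c.
Proof.
  intros [_ [HC1 _]] J0 d_gt0 Hf.
  assert (Hover : over J (0, 0, 0)) by (unfold over; now rewrite radius_on_axis by lra).
  destruct (HC1 _ Hover) as [[Hx _] _].
  pose (g := fun x => 0 - f (radius (x, 0, 0))).
  assert (Hg : is_lim g 0 (g 0)).
  { apply is_lim_continuity, continuity_pt_filterlim.
    exact (ex_derive_continuous _ _ Hx). }
  assert (Hg' : is_lim g 0 (- c)).
  { apply is_lim_ext_loc with (fun _ => - c); [|apply is_lim_const].
    exists (mkposreal d d_gt0); intros x Hball x_neq0.
    unfold ball in Hball; simpl in Hball.
    unfold AbsRing_ball, abs, minus, plus, opp in Hball; simpl in Hball.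
    rewrite Ropp_0, Rplus_0_r in Hball.
    unfold g, radius; replace (x ^ 2 + 0 ^ 2) with (Rsqr x) by (unfold Rsqr; ring).
    rewrite sqrt_Rsqr_abs, Hf; [ring|]; split; auto; now apply Rabs_pos_lt. }
  assert (Heq : g 0 = - c).
  { apply is_lim_unique in Hg; apply is_lim_unique in Hg'.
    rewrite Hg in Hg'; now injection Hg'. }
  unfold g in Heq; rewrite radius_on_axis in Heq by lra; lra.
Qed.

(** * The curvature as a radial derivative *)

Definition profile_norm (f : R -> R) (r : R) : R :=
  sqrt (Derive f r ^ 2 + 4 * r ^ 2).

(** Up to sign, [2 pi * flux f r] is the flux of the horizontal unit normal,
    projected to the plane, through the circle of radius [r]. *)
Definition flux (f : R -> R) (r : R) : R :=
  r * Derive f r / profile_norm f r.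

Lemma profile_norm_gt0 (f : R -> R) (r : R) : 0 < r -> 0 < profile_norm f r.
Proof. intros H; apply sqrt_lt_R0; generalize (pow2_ge_0 (Derive f r)); nra. Qed.

Lemma hgrad_norm_revol (J : R -> Prop) (f : R -> R) (x y t : R) :
  surface_of_revolution J f ->
  J (radius (x, y, t)) -> 0 < radius (x, y, t) ->
  hgrad_norm (revol f) (x, y, t) = profile_norm f (radius (x, y, t)).
Proof.
  intros HS HJ Hr; unfold hgrad_norm, profile_norm, hX, hY.
  rewrite (dx_revol J), (dy_revol J), dt_revol by auto; f_equal.
  set (F := Derive f _).
  generalize (radius_sqr x y t); intros Hrr.
  set (r := radius (x, y, t)) in *.
  transitivity (F ^ 2 * ((x ^ 2 + y ^ 2) / r ^ 2) + 4 * (x ^ 2 + y ^ 2)).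
  - field; lra.
  - rewrite <- Hrr; field; lra.
Qed.

(** The unit field is split into its rotational and radial parts, both with
    coefficients that are functions of the radius; in this form it can be
    differentiated without expanding those coefficients. *)
Lemma hX_unit_revol (J : R -> Prop) (f : R -> R) (x y t : R) :
  surface_of_revolution J f ->
  J (radius (x, y, t)) -> 0 < radius (x, y, t) ->
  hX (revol f) (x, y, t) / hgrad_norm (revol f) (x, y, t) =
  2 * y * / profile_norm f (radius (x, y, t))
  - x * (flux f (radius (x, y, t)) / radius (x, y, t) ^ 2).
Proof.
  intros HS HJ Hr; rewrite (hgrad_norm_revol J) by auto.
  unfold flux, hX; rewrite (dx_revol J), dt_revol by auto.
  generalize (profile_norm_gt0 f _ Hr); intros; field; lra.
Qed.

Lemma hY_unit_revol (J : R -> Prop) (f : R -> R) (x y t : R) :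
  surface_of_revolution J f ->
  J (radius (x, y, t)) -> 0 < radius (x, y, t) ->
  hY (revol f) (x, y, t) / hgrad_norm (revol f) (x, y, t) =
  - (2 * x) * / profile_norm f (radius (x, y, t))
  - y * (flux f (radius (x, y, t)) / radius (x, y, t) ^ 2).
Proof.
  intros HS HJ Hr; rewrite (hgrad_norm_revol J) by auto.
  unfold flux, hY; rewrite (dy_revol J), dt_revol by auto.
  generalize (profile_norm_gt0 f _ Hr); intros; field; lra.
Qed.

Lemma ex_derive_profile_norm (f : R -> R) (r : R) :
  0 < r -> ex_derive (Derive f) r -> ex_derive (profile_norm f) r.
Proof.
  intros Hr Hf; unfold profile_norm; auto_derive; repeat split; auto.
  generalize (pow2_ge_0 (Derive f r)); nra.
Qed.

Lemma ex_derive_flux (f : R -> R) (r : R) :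
  0 < r -> ex_derive (Derive f) r -> ex_derive (flux f) r.
Proof.
  intros Hr Hf; unfold flux; auto_derive; repeat split; auto.
  - now apply ex_derive_profile_norm.
  - generalize (profile_norm_gt0 f r Hr); lra.
Qed.

Lemma is_derive_polar_component (A B : R -> R) (c z la lb : R) :
  is_derive A z la -> is_derive B z lb ->
  is_derive (fun z' => c * B z' - z' * A z') z (c * lb - (A z + z * la)).
Proof.
  intros HA HB; auto_derive; [repeat split; eexists; eassumption|].
  replace (Derive (fun x => A x) z) with la
    by (symmetry; now apply is_derive_unique).
  replace (Derive (fun x => B x) z) with lb
    by (symmetry; now apply is_derive_unique).
  ring.
Qed.

(** With [a = flux f / r^2] and [b = 1 / N], the divergence of
    [(2 y b - x a, - 2 x b - y a)] is [- 2 a - r a'], because the two terms in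
    [b'] cancel; this equals [- (r^2 a)' / r]. *)
Lemma hcurv_revol (J : R -> Prop) (f : R -> R) (x y t : R) :
  surface_of_revolution J f ->
  J (radius (x, y, t)) -> 0 < radius (x, y, t) ->
  hcurv (revol f) (x, y, t) =
  - (Derive (flux f) (radius (x, y, t)) / radius (x, y, t)).
Proof.
  intros HS HJ Hr.
  pose (a := fun r => flux f r / r ^ 2).
  pose (b := fun r => / profile_norm f r).
  assert (Hloc := radial_interval_pos_locally J _ (proj1 HS) HJ Hr).
  assert (Hf2 := profile_ex_derive2 J f _ HS HJ Hr).
  assert (HN := profile_norm_gt0 f _ Hr).
  set (r := radius (x, y, t)) in *.
  assert (Hflux := ex_derive_flux f r Hr Hf2).
  assert (Ha : is_derive a r (Derive (flux f) r / r ^ 2 - 2 * flux f r / r ^ 3)).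
  { unfold a; auto_derive; [repeat split; auto; nra|].
    change (Derive (fun x0 : R => flux f x0) r) with (Derive (flux f) r); field; lra. }
  assert (Hb : ex_derive b r).
  { unfold b; auto_derive; repeat split; [now apply ex_derive_profile_norm|lra]. }
  destruct Hb as [lb Hb].
  unfold hcurv, hX at 1, hY at 1.
  assert (Hx : dx (fun q => hX (revol f) q / hgrad_norm (revol f) q) (x, y, t) =
     2 * y * (lb * (x / r)) - (a r + x * ((Derive (flux f) r / r ^ 2 - 2 * flux f r / r ^ 3) * (x / r)))).
  { unfold dx; apply is_derive_unique.
    apply is_derive_ext_loc with (fun x' => 2 * y * b (radius (x', y, t)) - x' * a (radius (x', y, t))).
    - generalize (locally_radius_x _ x y t Hr Hloc); apply filter_imp.
      intros x' [J' r']; unfold a, b; now rewrite (hX_unit_revol J).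
    - assert (Hax := is_derive_radial_x a x y t _ Hr Ha).
      assert (Hbx := is_derive_radial_x b x y t _ Hr Hb).
      exact (is_derive_polar_component _ _ _ _ _ _ Hax Hbx). }
  assert (Hy : dy (fun q => hY (revol f) q / hgrad_norm (revol f) q) (x, y, t) =
     - (2 * x) * (lb * (y / r)) - (a r + y * ((Derive (flux f) r / r ^ 2 - 2 * flux f r / r ^ 3) * (y / r)))).
  { unfold dy; apply is_derive_unique.
    apply is_derive_ext_loc with (fun y' => - (2 * x) * b (radius (x, y', t)) - y' * a (radius (x, y', t))).
    - generalize (locally_radius_y _ x y t Hr Hloc); apply filter_imp.
      intros y' [J' r']; unfold a, b; now rewrite (hY_unit_revol J).
    - assert (Hay := is_derive_radial_y a x y t _ Hr Ha).
      assert (Hby := is_derive_radial_y b x y t _ Hr Hb).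
      exact (is_derive_polar_component _ _ _ _ _ _ Hay Hby). }
  assert (Htx : dt (fun q => hX (revol f) q / hgrad_norm (revol f) q) (x, y, t) = 0).
  { unfold dt; rewrite (Derive_ext _ (fun _ => hX (revol f) (x, y, t) / hgrad_norm (revol f) (x, y, t))).
    - apply Derive_const.
    - intros t'; rewrite !(hX_unit_revol J); auto. }
  assert (Hty : dt (fun q => hY (revol f) q / hgrad_norm (revol f) q) (x, y, t) = 0).
  { unfold dt; rewrite (Derive_ext _ (fun _ => hY (revol f) (x, y, t) / hgrad_norm (revol f) (x, y, t))).
    - apply Derive_const.
    - intros t'; rewrite !(hY_unit_revol J); auto. }
  rewrite Hx, Hy, Htx, Hty.
  transitivity (- 2 * a r - (Derive (flux f) r / r ^ 2 - 2 * flux f r / r ^ 3) * ((x ^ 2 + y ^ 2) / r)).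
  - field; lra.
  - rewrite <- (radius_sqr x y t); fold r; unfold a; field; lra.
Qed.

(** * The profile equation *)

(** Each positive radius in [J] is realised by the noncharacteristic surface
    point [(r, 0, f r)]; conversely, noncharacteristic points have positive
    radius. *)
Lemma constant_hcurv_flux (J : R -> Prop) (f : R -> R) (h : R) :
  surface_of_revolution J f ->
  (constant_hcurv (over J) (revol f) h <->
   forall r, J r -> 0 < r -> Derive (flux f) r = - (h * r)).
Proof.
  intros HS; split.
  - intros Hh r Jr r_gt0.
    assert (Hrad : radius (r, 0, f r) = r) by (apply radius_on_axis; lra).
    assert (Hc := Hh (r, 0, f r)).
    rewrite (hcurv_revol J) in Hc by (rewrite ?Hrad; auto).
    rewrite Hrad in Hc; rewrite <- Hc; [field; lra| | |].
    + unfold over; now rewrite Hrad.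
    + unfold revol; rewrite Hrad; ring.
    + unfold noncharacteristic.
      rewrite (hgrad_norm_revol J), Hrad by (rewrite ?Hrad; auto).
      generalize (profile_norm_gt0 f r r_gt0); lra.
  - intros Hflux [[x y] t] Hover _ Hnc.
    assert (Hr := revol_axis_characteristic J f x y t HS Hover Hnc).
    rewrite (hcurv_revol J), Hflux by auto; field; lra.
Qed.

Lemma constant_hcurv_first_integral (J : R -> Prop) (f : R -> R) (h : R) :
  surface_of_revolution J f ->
  (constant_hcurv (over J) (revol f) h <->
   exists C, forall r, J r -> 0 < r -> flux f r = - (fam_s h C r / 4)).
Proof.
  intros HS; rewrite (constant_hcurv_flux J) by auto; unfold fam_s; split.
  - intros Hflux.
    destruct (radial_interval_constant J (fun r => flux f r + h * r ^ 2 / 2) (proj1 HS)) as [c Hc].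
    + intros r Jr r_gt0.
      assert (Hd := ex_derive_flux f r r_gt0 (profile_ex_derive2 J f r HS Jr r_gt0)).
      auto_derive; auto.
      change (Derive (fun x : R => flux f x) r) with (Derive (flux f) r).
      rewrite Hflux by auto; field.
    + exists (-4 * c); intros r Jr r_gt0; specialize (Hc r Jr r_gt0); simpl in Hc; lra.
  - intros [C HC] r Jr r_gt0; apply is_derive_unique.
    apply is_derive_ext_loc with (fun r => - ((2 * h * r ^ 2 + C) / 4)).
    + generalize (radial_interval_pos_locally J r (proj1 HS) Jr r_gt0).
      apply filter_imp; intros r' [J' r'_gt0]; now rewrite HC.
    + auto_derive; auto; field.
Qed.

(** With [N = sqrt (p^2 + 4 r^2)] and [D = sqrt (16 r^2 - s^2)], either side
    implies [D N = 8 r^2], which exchanges the two denominators: the left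
    side then becomes [4 r p = - s N], the right side [p D = - 2 r s]. *)
Lemma flux_slope (r p s : R) :
  0 < r ->
  (r * p / sqrt (p ^ 2 + 4 * r ^ 2) = - (s / 4) <->
   0 < 16 * r ^ 2 - s ^ 2 /\ p = - (2 * r * s) / sqrt (16 * r ^ 2 - s ^ 2)).
Proof.
  intros r_gt0.
  assert (HN : 0 < sqrt (p ^ 2 + 4 * r ^ 2)) by (apply sqrt_lt_R0; nra).
  assert (HN2 : sqrt (p ^ 2 + 4 * r ^ 2) ^ 2 = p ^ 2 + 4 * r ^ 2) by (apply pow2_sqrt; nra).
  set (N := sqrt (p ^ 2 + 4 * r ^ 2)) in *; clearbody N.
  (* Both directions only establish [D N = 8 r^2] after squaring. *)
  assert (Hprod : forall D, 0 < D -> D ^ 2 * N ^ 2 = 64 * r ^ 4 -> D * N = 8 * r ^ 2).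
  { intros D HD Heq; assert (0 < D * N) by nra.
    assert ((D * N - 8 * r ^ 2) * (D * N + 8 * r ^ 2) = 0) by nra.
    assert (0 < r ^ 2) by nra.
    destruct (Rmult_integral _ _ H0); nra. }
  split.
  - intros Heq.
    assert (Hp : 4 * r * p = - s * N).
    { transitivity (4 * N * (r * p / N)); [field; lra|rewrite Heq; field]. }
    assert (Hrad : (16 * r ^ 2 - s ^ 2) * N ^ 2 = 64 * r ^ 4).
    { replace ((16 * r ^ 2 - s ^ 2) * N ^ 2) with (16 * r ^ 2 * N ^ 2 - (- s * N) ^ 2) by ring.
      rewrite <- Hp, HN2; ring. }
    assert (Hpos : 0 < 16 * r ^ 2 - s ^ 2).
    { assert (0 < r ^ 4) by (apply pow_lt; auto). assert (0 < N ^ 2) by nra. nra. }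
    split; auto.
    assert (HD := sqrt_lt_R0 _ Hpos).
    assert (HDN := Hprod _ HD); rewrite pow2_sqrt in HDN by lra; specialize (HDN Hrad).
    set (D := sqrt _) in *.
    replace (2 * r * s) with (s * (D * N) / (4 * r)) by (rewrite HDN; field; lra).
    replace (s * (D * N)) with (- (4 * r * p) * D) by (rewrite Hp; ring).
    field; lra.
  - intros [Hpos Hp].
    assert (HD := sqrt_lt_R0 _ Hpos).
    assert (HD2 : sqrt (16 * r ^ 2 - s ^ 2) ^ 2 = 16 * r ^ 2 - s ^ 2) by (apply pow2_sqrt; lra).
    set (D := sqrt _) in *; clearbody D.
    assert (HpD : p * D = - (2 * r * s)) by (rewrite Hp; field; lra).
    assert (HDN : D * N = 8 * r ^ 2).
    { apply Hprod; auto; rewrite HN2.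
      replace (D ^ 2 * (p ^ 2 + 4 * r ^ 2)) with ((p * D) ^ 2 + 4 * r ^ 2 * D ^ 2) by ring.
      rewrite HpD, HD2; ring. }
    replace (r * p / N) with (r * (p * D) / (D * N)) by (field; lra).
    rewrite HpD, HDN; field; lra.
Qed.

Lemma constant_hcurv_slope (J : R -> Prop) (f : R -> R) (h : R) :
  surface_of_revolution J f ->
  (constant_hcurv (over J) (revol f) h <->
   exists C, forall r, J r -> 0 < r ->
     0 < 16 * r ^ 2 - fam_s h C r ^ 2 /\
     Derive f r = - (2 * r * fam_s h C r) / sqrt (16 * r ^ 2 - fam_s h C r ^ 2)).
Proof.
  intros HS; rewrite (constant_hcurv_first_integral J) by auto.
  split; intros [C HC]; exists C; intros r Jr r_gt0;
    apply (flux_slope r (Derive f r)); auto; now apply HC.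
Qed.

Lemma profile_primitive (J : R -> Prop) (f P p : R -> R) :
  surface_of_revolution J f ->
  (forall r, J r -> 0 < r -> is_derive P r (p r)) ->
  ((forall r, J r -> 0 < r -> Derive f r = p r) <->
   exists C', forall r, J r -> 0 < r -> f r - C' = P r).
Proof.
  intros HS HP; split.
  - intros Hp.
    destruct (radial_interval_constant J (fun r => f r - P r) (proj1 HS)) as [c Hc].
    + intros r Jr r_gt0; replace 0 with (p r - p r) by ring.
      apply (is_derive_minus (V := R_NormedModule) f P); auto.
      rewrite <- Hp by auto; apply Derive_correct, (profile_ex_derive J); auto.
    + exists c; intros r Jr r_gt0; generalize (Hc r Jr r_gt0); simpl; lra.
  - intros [C' HC'] r Jr r_gt0; apply is_derive_unique.
    apply is_derive_ext_loc with (fun r => P r + C').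
    + generalize (radial_interval_pos_locally J r (proj1 HS) Jr r_gt0).
      apply filter_imp; intros x [Jx x_gt0]; rewrite <- HC' by auto; lra.
    + replace (p r) with (p r + 0) by ring.
      apply (is_derive_plus (V := R_NormedModule) P (fun _ => C')); auto.
      apply (is_derive_const (V := R_NormedModule)).
Qed.

(** * Nonzero curvature *)

Definition fam_profile (h C r : R) : R :=
  1 / (2 * h) * sqrt (fam_rad h C r)
  - 2 / h ^ 2 * asin ((fam_s h C r - 4 / h) / sqrt (fam_disc h C)).

Lemma fam_rad_eq (h C r : R) :
  h <> 0 -> fam_rad h C r = 16 * r ^ 2 - fam_s h C r ^ 2.
Proof. intros Hh; unfold fam_rad, fam_s; field; auto. Qed.

Lemma fam_rad_disc (h C r : R) :
  h <> 0 -> fam_rad h C r = fam_disc h C - (fam_s h C r - 4 / h) ^ 2.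
Proof. intros Hh; unfold fam_rad, fam_disc, fam_s; field; auto. Qed.

Lemma is_derive_asin (w : R) : -1 < w < 1 -> is_derive asin w (/ sqrt (1 - w ^ 2)).
Proof.
  intros Hw; apply is_derive_Reals.
  replace (w ^ 2) with (Rsqr w) by (unfold Rsqr; ring).
  replace (/ sqrt (1 - w²)) with (1 / sqrt (1 - w²)) by (unfold Rdiv; ring).
  now apply derive_pt_eq_1 with (derivable_pt_asin w Hw), derive_pt_asin.
Qed.

(** With [w = (s - 4 / h) / sqrt (fam_disc h C)] one has
    [1 - w^2 = fam_rad / fam_disc], so both terms have derivatives over the
    common denominator [sqrt fam_rad].  In terms of [s] the numerators are
    [(4 / h - s) / (2 h)] and [- 2 / h^2], which add up to [- s / (2 h)]. *)
Lemma is_derive_fam_profile (h C r : R) :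
  h <> 0 -> 0 < fam_rad h C r ->
  is_derive (fam_profile h C) r (- (2 * r * fam_s h C r) / sqrt (fam_rad h C r)).
Proof.
  intros Hh Hrad.
  assert (Hdisc : 0 < fam_disc h C).
  { rewrite fam_rad_disc in Hrad by auto; generalize (pow2_ge_0 (fam_s h C r - 4 / h)); lra. }
  assert (HE := sqrt_lt_R0 _ Hdisc).
  assert (HE2 : sqrt (fam_disc h C) ^ 2 = fam_disc h C) by (apply pow2_sqrt; lra).
  set (E := sqrt (fam_disc h C)) in *.
  assert (HD := sqrt_lt_R0 _ Hrad).
  pose (w := (fam_s h C r - 4 / h) / E).
  assert (Hw : 1 - w ^ 2 = fam_rad h C r / E ^ 2).
  { rewrite fam_rad_disc, <- HE2 by auto; unfold w; field; lra. }
  assert (Hwpos : 0 < 1 - w ^ 2).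
  { rewrite Hw; apply Rdiv_lt_0_compat; nra. }
  assert (Hsqrt : sqrt (1 - w ^ 2) = sqrt (fam_rad h C r) / E).
  { rewrite Hw, sqrt_div_alt by nra; f_equal; apply sqrt_pow2; lra. }
  assert (Hs : is_derive (fam_s h C) r (4 * h * r)).
  { unfold fam_s; auto_derive; auto; ring. }
  assert (Hr : is_derive (fam_rad h C) r (8 / h * (4 * h * r) - 2 * fam_s h C r * (4 * h * r))).
  { unfold fam_rad, fam_s; auto_derive; auto; field; auto. }
  assert (Hasin : is_derive (fun r => asin ((fam_s h C r - 4 / h) / E)) r
                    (4 * h * r / E * / sqrt (1 - w ^ 2))).
  { apply (is_derive_comp asin (fun r => (fam_s h C r - 4 / h) / E)).
    - apply is_derive_asin; split; nra.
    - unfold fam_s; auto_derive; auto; field; lra. }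
  assert (Hsq : is_derive (fun r => sqrt (fam_rad h C r)) r
     ((8 / h * (4 * h * r) - 2 * fam_s h C r * (4 * h * r)) / (2 * sqrt (fam_rad h C r)))).
  { now apply is_derive_sqrt. }
  rewrite Hsqrt in Hasin.
  unfold fam_profile; fold E.
  replace (- (2 * r * fam_s h C r) / sqrt (fam_rad h C r)) with
    (1 / (2 * h) * ((8 / h * (4 * h * r) - 2 * fam_s h C r * (4 * h * r)) / (2 * sqrt (fam_rad h C r)))
     - 2 / h ^ 2 * (4 * h * r / E * / (sqrt (fam_rad h C r) / E))) by (field; lra).
  apply (is_derive_minus (V := R_NormedModule)
    (fun r => 1 / (2 * h) * sqrt (fam_rad h C r)));
    now apply is_derive_scal.
Qed.

Lemma constant_hcurv_nonzero (J : R -> Prop) (f : R -> R) (h : R) :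
  surface_of_revolution J f -> h <> 0 ->
  (constant_hcurv (over J) (revol f) h <->
   exists C C', fam_disc h C > 0 /\
     forall r, J r -> 0 < r ->
       fam_rad h C r > 0 /\ f r - C' = fam_profile h C r).
Proof.
  intros HS Hh; rewrite (constant_hcurv_slope J) by auto; split.
  - intros [C HC].
    destruct (radial_interval_pos_witness J (proj1 HS)) as [[a [Ja a_gt0]]|Hno].
    + assert (Hrad : forall r, J r -> 0 < r -> 0 < fam_rad h C r).
      { intros r Jr r_gt0; rewrite fam_rad_eq by auto; now apply HC. }
      destruct (proj1 (profile_primitive J f (fam_profile h C) _ HS
        (fun r Jr r_gt0 => is_derive_fam_profile h C r Hh (Hrad r Jr r_gt0)))) as [C' HC'].
      * intros r Jr r_gt0; rewrite fam_rad_eq by auto; now apply HC.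
      * exists C, C'; split.
        -- generalize (Hrad a Ja a_gt0); rewrite fam_rad_disc by auto.
           generalize (pow2_ge_0 (fam_s h C a - 4 / h)); lra.
        -- intros r Jr r_gt0; split; [now apply Hrad|now apply HC'].
    + exists 0, 0; split.
      * unfold fam_disc; replace (16 / h ^ 2 - 8 * 0 / h) with (16 * (/ h) ^ 2) by (field; auto).
        generalize (Rinv_neq_0_compat h Hh); intros; nra.
      * intros r Jr; destruct (Hno r Jr).
  - intros (C & C' & _ & HC); exists C; intros r Jr r_gt0.
    rewrite <- fam_rad_eq by auto; split; [now apply HC|].
    refine (proj2 (profile_primitive J f (fam_profile h C) _ HS
      (fun r Jr r_gt0 => is_derive_fam_profile h C r Hh _)) _ r Jr r_gt0).
    + now apply HC.
    + exists C'; intros; now apply HC.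
Qed.

(** * Reversing the orientation *)

Lemma hX_ext (u v : heis -> R) (p : heis) :
  (forall q, u q = v q) -> hX u p = hX v p.
Proof.
  destruct p as [[x y] t]; intros Huv; unfold hX, dx, dt.
  f_equal; [|f_equal]; apply Derive_ext; intros; apply Huv.
Qed.

Lemma hY_ext (u v : heis -> R) (p : heis) :
  (forall q, u q = v q) -> hY u p = hY v p.
Proof.
  destruct p as [[x y] t]; intros Huv; unfold hY, dy, dt.
  f_equal; [|f_equal]; apply Derive_ext; intros; apply Huv.
Qed.

Lemma hX_opp (u : heis -> R) (p : heis) : hX (fun q => - u q) p = - hX u p.
Proof.
  destruct p as [[x y] t]; unfold hX, dx, dt; rewrite !Derive_opp; ring.
Qed.

Lemma hY_opp (u : heis -> R) (p : heis) : hY (fun q => - u q) p = - hY u p.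
Proof.
  destruct p as [[x y] t]; unfold hY, dy, dt; rewrite !Derive_opp; ring.
Qed.

Lemma hgrad_norm_opp (u : heis -> R) (p : heis) :
  hgrad_norm (fun q => - u q) p = hgrad_norm u p.
Proof. unfold hgrad_norm; rewrite hX_opp, hY_opp; f_equal; ring. Qed.

Lemma hcurv_opp (u : heis -> R) (p : heis) :
  hcurv (fun q => - u q) p = - hcurv u p.
Proof.
  unfold hcurv; rewrite Ropp_plus_distr; f_equal.
  - rewrite <- hX_opp; apply hX_ext; intros q.
    rewrite hX_opp, hgrad_norm_opp; unfold Rdiv; ring.
  - rewrite <- hY_opp; apply hY_ext; intros q.
    rewrite hY_opp, hgrad_norm_opp; unfold Rdiv; ring.
Qed.

Lemma constant_hcurv_opp (U : heis -> Prop) (u : heis -> R) (h : R) :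
  constant_hcurv U (fun p => - u p) h <-> constant_hcurv U u (- h).
Proof.
  unfold constant_hcurv, noncharacteristic; split; intros H p Up up nc.
  - specialize (H p Up); rewrite hgrad_norm_opp, hcurv_opp in H.
    rewrite <- H by (auto; lra); ring.
  - rewrite hgrad_norm_opp in nc; rewrite hcurv_opp, H by (auto; lra); ring.
Qed.

Lemma fam_disc_opp (h C : R) : h <> 0 -> fam_disc (- h) (- C) = fam_disc h C.
Proof. intros Hh; unfold fam_disc; field; auto. Qed.

Lemma fam_rad_opp (h C r : R) : h <> 0 -> fam_rad (- h) (- C) r = fam_rad h C r.
Proof. intros Hh; unfold fam_rad, fam_s; field; auto. Qed.

Lemma fam_profile_opp (h C r : R) :
  h <> 0 -> fam_profile (- h) (- C) r = - fam_profile h C r.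
Proof.
  intros Hh; unfold fam_profile; rewrite fam_rad_opp, fam_disc_opp by auto.
  replace ((fam_s (- h) (- C) r - 4 / - h) / sqrt (fam_disc h C))
    with (- ((fam_s h C r - 4 / h) / sqrt (fam_disc h C))).
  - rewrite asin_opp; field; auto.
  - replace (fam_s (- h) (- C) r - 4 / - h) with (- (fam_s h C r - 4 / h))
      by (unfold fam_s; field; auto).
    unfold Rdiv; ring.
Qed.

(** * Zero curvature *)

Lemma is_derive_minimal_profile (C r : R) :
  0 < 16 * r ^ 2 - C ^ 2 ->
  is_derive (fun r => - (C / 8) * sqrt (16 * r ^ 2 - C ^ 2)) r
    (- (2 * r * C) / sqrt (16 * r ^ 2 - C ^ 2)).
Proof.
  intros Hrad; generalize (sqrt_lt_R0 _ Hrad); intros HD.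
  auto_derive; [lra|].
  replace (16 * (r * (r * 1)) + - (C * (C * 1))) with (16 * r ^ 2 - C ^ 2) by ring.
  field; lra.
Qed.

(** On the axis the equation says [(f 0 - C')^2 = - C^4 / 64].  It holds
    because [16 r^2 > C^2] at arbitrarily small radii forces [C = 0], and then
    [f] is constant near the axis. *)
Lemma minimal_profile_of_constant_hcurv (J : R -> Prop) (f : R -> R) :
  surface_of_revolution J f ->
  constant_hcurv (over J) (revol f) 0 ->
  exists C C', forall r, J r ->
    (f r - C') ^ 2 = (C / 8) ^ 2 * (16 * r ^ 2 - C ^ 2).
Proof.
  intros HS; rewrite (constant_hcurv_slope J) by auto; intros [C HC].
  assert (Hs : forall r, fam_s 0 C r = C) by (intros; unfold fam_s; ring).
  assert (Hrad : forall r, J r -> 0 < r -> 0 < 16 * r ^ 2 - C ^ 2).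
  { intros r Jr r_gt0; destruct (HC r Jr r_gt0) as [H _]; now rewrite Hs in H. }
  destruct (proj1 (profile_primitive J f _ _ HS
    (fun r Jr r_gt0 => is_derive_minimal_profile C r (Hrad r Jr r_gt0)))) as [C' HC'].
  { intros r Jr r_gt0; destruct (HC r Jr r_gt0) as [_ H]; now rewrite Hs in H. }
  exists C, C'; intros r Jr.
  destruct (proj1 (proj1 HS) r Jr) as [r_gt0|<-].
  - rewrite HC' by auto; generalize (Hrad r Jr r_gt0); intros Hr.
    rewrite Rpow_mult_distr, pow2_sqrt by lra; ring.
  - destruct (radial_interval_near_axis J (proj1 HS) Jr) as (d & d_gt0 & HJd).
    assert (HC0 : C = 0).
    { destruct (Req_dec C 0) as [|HC0]; auto.
      assert (HaC := Rabs_pos_lt C HC0).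
      pose (r := Rmin (d / 2) (Rabs C / 4)).
      assert (Hr : 0 < r) by (apply Rmin_glb_lt; lra).
      assert (Hrd : r <= d / 2) by apply Rmin_l.
      assert (HrC : r <= Rabs C / 4) by apply Rmin_r.
      assert (Jr' : J r) by (apply HJd; lra).
      assert (H := Hrad r Jr' Hr).
      assert (0 <= (Rabs C - 4 * r) * (Rabs C + 4 * r)) by (apply Rmult_le_pos; lra).
      rewrite <- (pow2_abs C) in H; lra. }
    subst C.
    assert (Hf : forall r, 0 < r < d -> f r = C').
    { intros r Hr; assert (H := HC' r (HJd r Hr) (proj1 Hr)); simpl in H; lra. }
    assert (Hf0 : f 0 = C'); [|rewrite Hf0; field].
    now apply (profile_axis_value J f d).
Qed.

(** Differentiation gives [(f - C') f' = C^2 r / 4]; with the equation itself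
    this yields [(16 r^2 - C^2) f'^2 = 4 C^2 r^2], that is
    [flux^2 = (C / 4)^2].  No choice of a branch of the square root is made:
    a differentiable function with constant square has zero derivative. *)
Lemma constant_hcurv_of_minimal_profile (J : R -> Prop) (f : R -> R) (C C' : R) :
  surface_of_revolution J f ->
  (forall r, J r -> (f r - C') ^ 2 = (C / 8) ^ 2 * (16 * r ^ 2 - C ^ 2)) ->
  constant_hcurv (over J) (revol f) 0.
Proof.
  intros HS Hf; rewrite (constant_hcurv_flux J) by auto.
  assert (Hloc : forall r, J r -> 0 < r -> locally r (fun r' => J r' /\ 0 < r')).
  { intros r; apply radial_interval_pos_locally, HS. }
  assert (Hslope : forall r, J r -> 0 < r -> (f r - C') * Derive f r = C ^ 2 * r / 4).
  { intros r Jr r_gt0.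
    assert (Hd : ex_derive f r) by (eapply profile_ex_derive; eauto).
    assert (H1 : is_derive (fun r => (f r - C') ^ 2) r (2 * (f r - C') * Derive f r)).
    { auto_derive; auto; change (Derive (fun x => f x) r) with (Derive f r); ring. }
    assert (H2 : is_derive (fun r => (f r - C') ^ 2) r (C ^ 2 * r / 2)).
    { apply is_derive_ext_loc with (fun r => (C / 8) ^ 2 * (16 * r ^ 2 - C ^ 2)).
      - generalize (Hloc r Jr r_gt0); apply filter_imp; intros x [Jx _].
        symmetry; now apply Hf.
      - auto_derive; auto; field. }
    apply is_derive_unique in H1; apply is_derive_unique in H2; lra. }
  assert (Hsq : forall r, J r -> 0 < r ->
            (16 * r ^ 2 - C ^ 2) * Derive f r ^ 2 = 4 * C ^ 2 * r ^ 2).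
  { intros r Jr r_gt0; destruct (Req_dec C 0) as [C_eq0|C_neq0].
    - replace (Derive f r) with 0; [rewrite C_eq0; ring|].
      symmetry; apply is_derive_unique.
      apply is_derive_ext_loc with (fun _ => C');
        [|apply (is_derive_const (V := R_NormedModule))].
      generalize (Hloc r Jr r_gt0); apply filter_imp; intros x [Jx _].
      assert (H := Hf x Jx); rewrite C_eq0 in H; nra.
    - assert (HC2 : 0 < (C / 8) ^ 2).
      { apply pow2_gt_0; unfold Rdiv; apply Rmult_integral_contrapositive; lra. }
      apply (Rmult_eq_reg_l ((C / 8) ^ 2)); [|lra].
      rewrite <- Rmult_assoc, <- Hf, <- Rpow_mult_distr, Hslope by auto; field. }
  assert (Hflux : forall r, J r -> 0 < r -> flux f r ^ 2 = (C / 4) ^ 2).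
  { intros r Jr r_gt0; assert (HN := profile_norm_gt0 f r r_gt0).
    assert (HN2 : profile_norm f r ^ 2 = Derive f r ^ 2 + 4 * r ^ 2).
    { apply pow2_sqrt; generalize (pow2_ge_0 (Derive f r)); nra. }
    apply (Rmult_eq_reg_r (16 * profile_norm f r ^ 2)); [|nra].
    transitivity (16 * r ^ 2 * Derive f r ^ 2); [unfold flux; field; lra|].
    rewrite HN2; generalize (Hsq r Jr r_gt0); lra. }
  intros r Jr r_gt0; rewrite Rmult_0_l, Ropp_0.
  destruct (Req_dec C 0) as [C_eq0|C_neq0].
  - apply is_derive_unique, is_derive_ext_loc with (fun _ => 0);
      [|apply (is_derive_const (V := R_NormedModule))].
    generalize (Hloc r Jr r_gt0); apply filter_imp; intros x [Jx x_gt0].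
    assert (H := Hflux x Jx x_gt0); rewrite C_eq0 in H; nra.
  - assert (Hd := ex_derive_flux f r r_gt0 (profile_ex_derive2 J f r HS Jr r_gt0)).
    assert (H1 : is_derive (fun r => flux f r ^ 2) r (2 * flux f r * Derive (flux f) r)).
    { auto_derive; auto; change (Derive (fun x => flux f x) r) with (Derive (flux f) r); ring. }
    assert (H2 : is_derive (fun r => flux f r ^ 2) r 0).
    { apply is_derive_ext_loc with (fun _ => (C / 4) ^ 2);
        [|apply (is_derive_const (V := R_NormedModule))].
      generalize (Hloc r Jr r_gt0); apply filter_imp; intros x [Jx x_gt0].
      symmetry; now apply Hflux. }
    apply is_derive_unique in H1; rewrite (is_derive_unique _ _ _ H2) in H1.
    assert (H := Hflux r Jr r_gt0).
    assert (0 < C ^ 2) by (apply pow2_gt_0; auto).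
    destruct (Rmult_integral _ _ (eq_sym H1)) as [Hflux0|]; auto.
    assert (Hr0 : flux f r = 0) by lra; nra.
Qed.

Theorem theorem4p10 (J : R -> Prop) (f : R -> R) (h : R)
  (Sigma : surface_of_revolution J f) :
  (h = 0 ->
    (constant_hcurv (over J) (revol f) h <->
     exists C C' : R, forall r : R, J r ->
       (f r - C') ^ 2 = (C / 8) ^ 2 * (16 * r ^ 2 - C ^ 2))) /\
  (h <> 0 ->
    (constant_hcurv (over J) (fun p => - revol f p) h <->
     exists C C' : R, fam_disc h C > 0 /\
       forall r : R, J r -> 0 < r ->
         fam_rad h C r > 0 /\
         f r - C' = - (1 / (2 * h)) * sqrt (fam_rad h C r)
                    + 2 / h ^ 2 *
                      asin ((fam_s h C r - 4 / h) / sqrt (fam_disc h C))) /\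
    (constant_hcurv (over J) (revol f) h <->
     exists C C' : R, fam_disc h C > 0 /\
       forall r : R, J r -> 0 < r ->
         fam_rad h C r > 0 /\
         f r - C' = 1 / (2 * h) * sqrt (fam_rad h C r)
                    - 2 / h ^ 2 *
                      asin ((fam_s h C r - 4 / h) / sqrt (fam_disc h C)))).
Proof.
  split.
  - intros ->; split.
    + now apply minimal_profile_of_constant_hcurv.
    + intros (C & C' & Hf); now apply (constant_hcurv_of_minimal_profile J f C C').
  - intros Hh; split; [|now apply constant_hcurv_nonzero].
    rewrite constant_hcurv_opp, (constant_hcurv_nonzero J) by (auto; lra).
    split; intros (C & C' & Hdisc & HC); exists (- C), C'; split.
    + rewrite <- (fam_disc_opp h), Ropp_involutive; auto.
    + intros r Jr r_gt0; destruct (HC r Jr r_gt0) as [Hrad Hf].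
      rewrite <- (Ropp_involutive C), fam_rad_opp in Hrad by auto.
      rewrite <- (Ropp_involutive C), fam_profile_opp in Hf by auto.
      split; auto; rewrite Hf; unfold fam_profile; ring.
    + rewrite fam_disc_opp; auto.
    + intros r Jr r_gt0; destruct (HC r Jr r_gt0) as [Hrad Hf].
      rewrite fam_rad_opp, fam_profile_opp by auto.
      split; auto; rewrite Hf; unfold fam_profile; ring.
Qed.
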